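(* Suppose that $f$ is continuously differentiable on an open set containing $\operatorname{dom}\varphi$, that $\varphi$ is proper, lower semicontinuous and prox-bounded, and that $\inf F>-\infty$. Let the algorithm described in the context be run, and suppose there exists $M_B>0$ with $\|B_k\|\le M_B$ for all $k\in\mathbb{N}_0$. Suppose further that $\nabla f$ is locally Lipschitz continuous on an open set containing $\operatorname{dom}\varphi$, i.e., for all $x\in\operatorname{dom}\varphi$ there exist $L,\varepsilon>0$ such that $\|\nabla f(y)-\nabla f(z)\|\le L\|y-z\|$ for all $y,z\in\mathbb{B}_\varepsilon(x)$. Finally, suppose that the set of stationary points of $F$ is nonempty, that there exists a stationary point $x^*$ of $F$ which is an accumulation point of the subsequence $\{x^k\}_{k\in\mathcal S}$ of successful iterates, and that $F$ has the Kurdyka--\L{}ojasiewicz property at $x^*$. Then the entire sequence $\{x^k\}$ converges to $x^*$.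
   Context: Problem: minimize $F(x):=f(x)+\varphi(x)$ over $x\in\mathbb{R}^n$, with $f:\mathbb{R}^n\to\mathbb{R}$ and $\varphi:\mathbb{R}^n\to\overline{\mathbb{R}}:=\mathbb{R}\cup\{\infty\}$. Here $\operatorname{dom}\varphi=\{x:\varphi(x)<\infty\}$; $\varphi$ is proper if $\operatorname{dom}\varphi\ne\emptyset$; $\varphi$ is prox-bounded if there exist $\gamma>0$ and $x\in\mathbb{R}^n$ with $\inf_{y}\{\varphi(y)+\frac{1}{2\gamma}\|y-x\|^2\}>-\infty$. As a standing assumption $F$ is proper and lower semicontinuous. $\partial$ denotes the limiting (Mordukhovich) subdifferential; $x$ is stationary if $0\in\partial F(x)$; $\mathbb{B}_\varepsilon(x)$ is the closed Euclidean ball; $\operatorname{dist}(x,C)=\inf_{y\in C}\|x-y\|$. Algorithm: parameters $c_1\in(0,1)$, $\sigma_2>1$, $0<\mu_{\min}\le\mu_{\max}<\infty$. Start with $x^0\in\operatorname{dom}\varphi$, a symmetric matrix $B_0\in\mathbb{R}^{n\times n}$ and $\mu_0\in[\mu_{\min},\mu_{\max}]$. For $k=0,1,2,\dots$ let $$q_k(x):=f(x^k)+\nabla f(x^k)^\top(x-x^k)+\tfrac12(x-x^k)^\top B_k(x-x^k)+\varphi(x),\quad G_k:=B_k+\mu_kI,\quad \hat q_k(x):=q_k(x)+\tfrac{\mu_k}{2}\|x-x^k\|^2 .$$ Search for a global minimizer $\hat x^k$ of $\hat q_k$ over $\mathbb{R}^n$. If one is found, set $d^k:=\hat x^k-x^k$,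 $\mathrm{ared}_k:=F(x^k)-F(\hat x^k)$, $\mathrm{pred}_k:=F(x^k)-q_k(\hat x^k)$. If $\hat x^k$ is found and $\mathrm{ared}_k\ge c_1\,\mathrm{pred}_k$ (iteration $k$ is successful), set $x^{k+1}=\hat x^k$ and choose an arbitrary symmetric $B_{k+1}\in\mathbb{R}^{n\times n}$ and an arbitrary $\mu_{k+1}\in[\mu_{\min},\mu_{\max}]$. Otherwise (unsuccessful), set $x^{k+1}=x^k$, $B_{k+1}=B_k$, $\mu_{k+1}=\sigma_2\mu_k$. Standing assumption: whenever $\hat q_k$ has a minimizer, a minimizer $\hat x^k$ is found. $\mathcal S$ is the set of successful iterations; an accumulation point of $\{x^k\}_{k\in\mathcal S}$ is a limit of $\{x^k\}_{k\in\mathcal L}$ for some infinite $\mathcal L\subset\mathcal S$. KL property: a proper lower semicontinuous $g:\mathbb{R}^n\to\overline{\mathbb{R}}$ has the Kurdyka--\L{}ojasiewicz property at $x^*$ with $\partial g(x^* )\neq\emptyset$ if there exist $\eta>0$, a neighborhood $U$ of $x^*$ and a continuous concave function $\chi:[0,\eta]\to[0,\infty)$ (desingularization function), continuously differentiable on $(0,\eta)$, with $\chi(0)=0$ and $\chi'(t)>0$ for all $t\in(0,\eta)$, such that $\chi'(g(x)-g(x^* ))\operatorname{dist}(0,\partial g(x))\ge1$ for all $x\in U$ with $g(x^* )<g(x)<g(x^* )+\eta$. *)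

(* Defs.v *)
From mathcomp Require Import all_boot all_order all_algebra.
From mathcomp Require Import all_classical all_reals all_analysis.
Import Order.TTheory GRing.Theory Num.Theory.
Import numFieldNormedType.Exports.

Set Implicit Arguments.
Unset Strict Implicit.
Unset Printing Implicit Defensive.

Local Open Scope classical_set_scope.
Local Open Scope ring_scope.

(* Points of R^n are row vectors.  The library's norm on ['rV[R]_n] is the
   maximum norm; it is only used through the topology it induces.  All metric
   quantities are expressed with the Euclidean norm [enorm]. *)
Section Euclidean.
Context {R : realType} {n : nat}.
Implicit Types (u v x y z : 'rV[R]_n) (C D : set 'rV[R]_n).

Definition dotv u v : R := \sum_i u 0 i * v 0 i.

Definition enorm u : R := Num.sqrt (dotv u u).

Definition ecball x (r : R) : set 'rV[R]_n := [set y | enorm (y - x) <= r].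

(* Extended-valued, so that the distance to the empty set is [+oo]. *)
Definition dist_set x C : \bar R := ereal_inf [set (enorm (x - y))%:E | y in C].

(* Spectral norm, i.e. the operator norm induced by [enorm]. *)
Definition opnorm (A : 'M[R]_n) : R :=
  sup [set enorm (v *m A) | v in [set v | enorm v <= 1]].

Definition gradient (f : 'rV[R]_n -> R) x : 'rV[R]_n :=
  \row_i 'D_(delta_mx 0 i) f x.

Definition continuously_differentiable_on (f : 'rV[R]_n -> R) D :=
  forall x, D x -> differentiable f x /\ {for x, continuous (gradient f)}.

Definition locally_lipschitz_at (g : 'rV[R]_n -> 'rV[R]_n) x :=
  exists L eps : R, [/\ 0 < L, 0 < eps &
    forall y z, ecball x eps y -> ecball x eps z ->
      enorm (g y - g z) <= L * enorm (y - z)].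

End Euclidean.

(* Functions R^n -> R \cup {+oo} are functions into [\bar R] that never take
   the value [-oo]; the latter is [no_ninfty]. *)
Section ExtendedValued.
Context {R : realType} {n : nat}.
Implicit Types (g : 'rV[R]_n -> \bar R) (x v : 'rV[R]_n).
Local Open Scope ereal_scope.

Definition no_ninfty g := forall x, -oo < g x.

Definition effdom g : set 'rV[R]_n := [set x | g x < +oo].

Definition proper_function g := effdom g !=set0.

Definition global_minimizer g x := forall y, g x <= g y.

Definition prox_bounded g :=
  exists (gamma : R) x, (0 < gamma)%R /\
    -oo < ereal_inf (range
      (fun y => g y + ((2 * gamma)^-1 * enorm (y - x) ^+ 2)%:E)).

(* Regular (Frechet) subdifferential; [x^'] is the filter of deleted
   neighbourhoods of [x]. *)
Definition regular_subdiff g x : set 'rV[R]_n :=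
  [set v | g x \is a fin_num /\
    0 <= limf_einf
      (fun y => (g y - g x - (dotv v (y - x))%:E) * ((enorm (y - x))^-1)%:E)
      (x^')].

(* Limiting (Mordukhovich) subdifferential, empty outside [effdom g]. *)
Definition limiting_subdiff g x : set 'rV[R]_n :=
  [set v | g x \is a fin_num /\
    exists y w : nat -> 'rV[R]_n,
      [/\ y @ \oo --> x,
          g (y k) @[k --> \oo] --> g x,
          w @ \oo --> v &
          forall k, regular_subdiff g (y k) (w k)]].

Definition stationary g x := limiting_subdiff g x 0%R.

Definition desingularization (eta : R) (chi : R -> R) : Prop :=
  [/\ {within `[0%R, eta], continuous chi} /\
      convex_function `[0%R, eta]%classic (fun t => - chi t)%R,
      forall t, t \in `[0%R, eta] -> (0 <= chi t)%R,
      forall t, t \in `]0%R, eta[ ->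
        derivable chi t 1 /\ {for t, continuous (derive1 chi)},
      chi 0%R = 0%R &
      forall t, t \in `]0%R, eta[ -> (0 < derive1 chi t)%R].

Definition KL_property g x :=
  limiting_subdiff g x !=set0 /\
  exists (eta : R) (U : set 'rV[R]_n) (chi : R -> R),
    [/\ (0 < eta)%R, nbhs x U, desingularization eta chi &
      forall y, U y -> g x < g y -> g y < g x + eta%:E ->
        1 <= (derive1 chi (fine (g y - g x)))%:E * dist_set 0%R (limiting_subdiff g y)].

End ExtendedValued.

Section Algorithm.
Context {R : realType} {n : nat}.
Variables (f : 'rV[R]_n -> R) (phi : 'rV[R]_n -> \bar R).
Local Open Scope ereal_scope.

Definition objective (x : 'rV[R]_n) : \bar R := (f x)%:E + phi x.

Definition model (xk : 'rV[R]_n) (Bk : 'M[R]_n) (x : 'rV[R]_n) : \bar R :=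
  (f xk + dotv (gradient f xk) (x - xk)
    + 2^-1 * dotv ((x - xk) *m Bk) (x - xk))%:E + phi x.

Definition reg_model (xk : 'rV[R]_n) (Bk : 'M[R]_n) (muk : R)
    (x : 'rV[R]_n) : \bar R :=
  model xk Bk x + (muk / 2 * enorm (x - xk) ^+ 2)%:E.

(* [xhat k = None] means that no minimizer was found in iteration [k]. *)
Variables (c1 sigma2 mumin mumax : R).
Variables (x : nat -> 'rV[R]_n) (B : nat -> 'M[R]_n) (mu : nat -> R).
Variable (xhat : nat -> option 'rV[R]_n).

Definition ared (k : nat) (z : 'rV[R]_n) : \bar R :=
  objective (x k) - objective z.

Definition pred_red (k : nat) (z : 'rV[R]_n) : \bar R :=
  objective (x k) - model (x k) (B k) z.

Definition successful : set nat :=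
  [set k | exists2 z, xhat k = Some z & c1%:E * pred_red k z <= ared k z].

Record algorithm_run : Prop := AlgorithmRun {
  run_x0 : effdom phi (x 0%N);
  run_B0 : (B 0%N)^T = B 0%N;
  run_mu0 : (mumin <= mu 0%N <= mumax)%R;
  run_found : forall k z, xhat k = Some z ->
    global_minimizer (reg_model (x k) (B k) (mu k)) z;
  run_search : forall k,
    (exists z, global_minimizer (reg_model (x k) (B k) (mu k)) z) ->
    xhat k <> None;
  run_success : forall k, successful k ->
    [/\ xhat k = Some (x k.+1),
        (B k.+1)^T = B k.+1 &
        (mumin <= mu k.+1 <= mumax)%R];
  run_failure : forall k, ~ successful k ->
    [/\ x k.+1 = x k, B k.+1 = B k & mu k.+1 = (sigma2 * mu k)%R]
}.

End Algorithm.

(* Convergence along [within L \oo] is convergence of the subsequence indexed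
   by [L]. *)
Definition accumulation_point_along {R : realType} {n : nat}
    (x : nat -> 'rV[R]_n) (S : set nat) (a : 'rV[R]_n) :=
  exists L : set nat,
    [/\ infinite_set L, L `<=` S & x @ within L \oo --> a].

(* Main.v *)
Require Import Defs.
From mathcomp Require Import all_boot all_order all_algebra.
From mathcomp Require Import all_classical all_reals all_analysis.
From mathcomp Require Import ring lra.
Import Order.TTheory GRing.Theory Num.Theory.
Import numFieldNormedType.Exports.
Local Open Scope classical_set_scope.
Local Open Scope ring_scope.

(** The proof rests on three facts about iterates close to the limit point
    [xstar], which lies in the domain of [phi] because it is stationary.

    - [f] satisfies a quadratic first-order error bound on a ball around
      [xstar], because its gradient is Lipschitz there ([first_order_error]).
    - The regularization parameters stay bounded while the iterates remain in a
      smaller ball ([mu_bounded_near]).  Prox-boundedness of [phi] makes the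
      regularized model coercive for large [mu], so that a minimizer exists and
      lies close to the current iterate ([sublevel_localized],
      [minimizer_exists]); the error bound then makes the iteration successful
      ([sufficient_decrease]).
    - Hence a successful step of length [s] lowers [F] by at least a constant
      times [s ^ 2] ([success_decrease]), and the optimality condition of the
      subproblem gives a subgradient of [F] at the new iterate of norm at most a
      constant times [s] ([subgradient_step]).

    Comparing the minimizer of the subproblem with [xstar] shows that the values
    [F (x k)] decrease to [F xstar] ([value_after_step],
    [short_step_near_limit]).  The conclusion then follows from
    [KL_convergence].  Let [a] and [b] be the two constants above, [e] the
    length of the last successful step and [chi] the desingularization function.
    The Kurdyka-Lojasiewicz inequality and the concavity of [chi] give
    [2 s <= e + (b / a) (chi_k - chi_(k+1))] for the next successful step, where
    [chi_k] is the value of [chi] at [F (x k) - F xstar].  Therefore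
    [|x k - xstar| + e + (b / a) chi_k] does not increase as long as it is
    small.  It becomes arbitrarily small right after a short successful step
    near [xstar], so the whole sequence converges to [xstar], without any
    reindexing along the successful iterations. *)

Set Implicit Arguments.
Unset Strict Implicit.
Unset Printing Implicit Defensive.

(** * Euclidean geometry of row vectors *)

Section EuclideanTheory.
Context {R : realType} {n : nat}.
Implicit Types (u v w x y z : 'rV[R]_n) (a b : R) (A : 'M[R]_n).

Lemma dotvC u v : dotv u v = dotv v u.
Proof. by apply: eq_bigr => i _; rewrite mulrC. Qed.

Lemma dotvDl u v w : dotv (u + v) w = dotv u w + dotv v w.
Proof. by rewrite -big_split; apply: eq_bigr => i _; rewrite mxE mulrDl. Qed.

Lemma dotvZl a u v : dotv (a *: u) v = a * dotv u v.
Proof. by rewrite mulr_sumr; apply: eq_bigr => i _; rewrite mxE mulrA. Qed.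

Lemma dotvNl u v : dotv (- u) v = - dotv u v.
Proof. by rewrite -scaleN1r dotvZl mulN1r. Qed.

Lemma dotvBl u v w : dotv (u - v) w = dotv u w - dotv v w.
Proof. by rewrite dotvDl dotvNl. Qed.

Lemma dotvDr u v w : dotv u (v + w) = dotv u v + dotv u w.
Proof. by rewrite dotvC dotvDl !(dotvC u). Qed.

Lemma dotvZr a u v : dotv u (a *: v) = a * dotv u v.
Proof. by rewrite dotvC dotvZl dotvC. Qed.

Lemma dotvNr u v : dotv u (- v) = - dotv u v.
Proof. by rewrite dotvC dotvNl dotvC. Qed.

Lemma dotvBr u v w : dotv u (v - w) = dotv u v - dotv u w.
Proof. by rewrite dotvDr dotvNr. Qed.

Lemma dotv0 u : dotv u 0 = 0.
Proof. by rewrite -(scale0r u) dotvZr mul0r. Qed.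

Lemma dotv_ge0 u : 0 <= dotv u u.
Proof. by apply: sumr_ge0 => i _; rewrite -expr2 sqr_ge0. Qed.

Lemma dotv_mulmx_sym A u v : A^T = A -> dotv (u *m A) v = dotv (v *m A) u.
Proof.
have E w w' : dotv w w' = (w *m w'^T) 0 0.
  by rewrite mxE; apply: eq_bigr => i _; rewrite mxE.
move=> sA; rewrite !E -[in RHS](trmxK (v *m A *m u^T)) [RHS]mxE.
by rewrite !trmx_mul !trmxK sA mulmxA.
Qed.

Lemma enorm_ge0 u : 0 <= enorm u. Proof. exact: sqrtr_ge0. Qed.

Lemma enorm_sqr u : enorm u ^+ 2 = dotv u u.
Proof. by rewrite sqr_sqrtr// dotv_ge0. Qed.

Lemma enormZ a u : enorm (a *: u) = `|a| * enorm u.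
Proof.
by rewrite /enorm dotvZl dotvZr mulrA -expr2 sqrtrM ?sqr_ge0// sqrtr_sqr.
Qed.

Lemma enormN u : enorm (- u) = enorm u.
Proof. by rewrite -scaleN1r enormZ normrN1 mul1r. Qed.

Lemma enorm0 : enorm (0 : 'rV[R]_n) = 0.
Proof. by rewrite /enorm dotv0 sqrtr0. Qed.

Lemma enormB u v : enorm (u - v) = enorm (v - u).
Proof. by rewrite -enormN opprB. Qed.

Lemma coord_le_enorm u i : `|u 0 i| <= enorm u.
Proof.
rewrite -sqrtr_sqr ler_sqrt ?dotv_ge0// /dotv (bigD1 i)//= expr2 lerDl.
by apply: sumr_ge0 => j _; rewrite -expr2 sqr_ge0.
Qed.

Lemma enorm_eq0 u : enorm u = 0 -> u = 0.
Proof.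
move=> u0; apply/rowP => i; rewrite mxE; apply/eqP; rewrite -normr_le0 -u0.
exact: coord_le_enorm.
Qed.

Lemma enorm_gt0 u : u != 0 -> 0 < enorm u.
Proof.
move=> u0; rewrite lt_neqAle enorm_ge0 andbT eq_sym.
by apply: contra_neq u0; exact: enorm_eq0.
Qed.

(** Cauchy-Schwarz. *)
Lemma dotv_le u v : dotv u v <= enorm u * enorm v.
Proof.
have [->|u0] := eqVneq u 0; first by rewrite dotvC dotv0 enorm0 mul0r.
have [->|v0] := eqVneq v 0; first by rewrite dotv0 enorm0 mulr0.
have := dotv_ge0 (enorm v *: u - enorm u *: v).
rewrite dotvBl !dotvBr !dotvZl !dotvZr -!enorm_sqr (dotvC v u).
move: (enorm_gt0 u0) (enorm_gt0 v0) (dotv u v) => {u0 v0}.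
move: (enorm u) (enorm v) => a b a0 b0 d H.
have ab0 : 0 < a * b by rewrite mulr_gt0.
rewrite -(ler_pM2l ab0); lra.
Qed.

Lemma normr_dotv_le u v : `|dotv u v| <= enorm u * enorm v.
Proof. by rewrite ler_norml dotv_le andbT lerNl -dotvNl -(enormN u) dotv_le. Qed.

Lemma enormD u v : enorm (u + v) <= enorm u + enorm v.
Proof.
rewrite -(ler_pXn2r (ltn0Sn 1)) ?nnegrE ?addr_ge0 ?enorm_ge0// enorm_sqr.
rewrite dotvDl !dotvDr (dotvC v u) -!enorm_sqr.
have := dotv_le u v; lra.
Qed.

Lemma enorm_triangle y x z : enorm (x - z) <= enorm (x - y) + enorm (y - z).
Proof. by rewrite -[x - z](subrKA y) enormD. Qed.

(** ** Comparison with the topology of the maximum norm *)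

Lemma norm_le_enorm u : `|u| <= enorm u.
Proof.
rewrite -[`|u|]/(mx_norm u) mx_normrE; apply/bigmax_leP; split => /=.
  exact: enorm_ge0.
by case=> i j _ /=; rewrite (ord1 i) coord_le_enorm.
Qed.

Lemma enorm_le_norm u : enorm u <= n.+1%:R * `|u|.
Proof.
have c i : `|u 0 i| <= `|u|.
  rewrite -[`|u|]/(mx_norm u) mx_normrE.
  exact: (le_bigmax _ (fun ij => `|u ij.1 ij.2|) (0, i)).
rewrite -(ler_pXn2r (ltn0Sn 1)) ?nnegrE ?mulr_ge0 ?enorm_ge0// enorm_sqr.
apply: (@le_trans _ _ (\sum_(i < n) `|u| ^+ 2)).
  apply: ler_sum => i _; rewrite -expr2 -real_normK ?num_real//.
  by rewrite lerXn2r ?nnegrE ?normr_ge0.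
rewrite sumr_const card_ord exprMn -[_ *+ n]mulr_natl ler_wpM2r ?sqr_ge0//.
by rewrite -natrX ler_nat (leq_trans (leqnSn n))// leq_pmulr.
Qed.

Lemma nbhs_enormP x (U : set 'rV[R]_n) :
  nbhs x U <-> exists2 d : R, 0 < d & forall y, enorm (y - x) < d -> U y.
Proof.
split=> [/nbhs_ballP[d d0 dU]|[d d0 dU]].
- exists d => // y yx; apply: dU.
  by rewrite -ball_normE /= distrC (le_lt_trans (norm_le_enorm _)).
- apply/nbhs_ballP; exists (d / n.+1%:R); first by rewrite /= divr_gt0.
  move=> y; rewrite -ball_normE /= distrC => yx; apply: dU.
  by rewrite (le_lt_trans (enorm_le_norm _))// mulrC -ltr_pdivlMr.
Qed.

Lemma cvg_enorm (u : nat -> 'rV[R]_n) x :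
  (forall d, 0 < d -> \forall k \near \oo, enorm (u k - x) < d) ->
  u @ \oo --> x.
Proof.
move=> ux U /nbhs_enormP[d d0 dU].
by apply: filterS (ux d d0) => k; exact: dU.
Qed.

Lemma continuous_enorm_sub x : continuous (fun y => enorm (y - x) : R).
Proof.
move=> y; apply/(@cvgrPdist_lt _ _ _ (nbhs y) _) => e e0.
apply/nbhs_enormP; exists e => // z zy.
rewrite (le_lt_trans _ zy)// ler_norml; apply/andP; split.
- by have := enorm_triangle y z x; lra.
- by have := enorm_triangle z y x; rewrite (enormB y z); lra.
Qed.

Lemma ecball_compact x r : compact (ecball x r).
Proof.
apply: bounded_closed_compact.
  exists (enorm x + r); split; first exact: num_real.
  move=> M M0 y; rewrite /ecball /= => yr.
  rewrite (le_trans (norm_le_enorm _))// (le_trans _ (ltW M0))//.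
  by have := enormD (y - x) x; rewrite subrK; lra.
rewrite (_ : ecball x r = (fun y => enorm (y - x)) @^-1` [set t | t <= r])//.
by apply: preimage_closed; [move=> ? _; exact: continuous_enorm_sub|exact: closed_le].
Qed.

(** ** The operator norm *)

Lemma opnorm_bounded A : exists2 C, 0 <= C & forall v, enorm (v *m A) <= C * enorm v.
Proof.
exists (n.+1%:R * \sum_i \sum_j `|A i j|).
  by rewrite mulr_ge0// sumr_ge0// => i _; rewrite sumr_ge0.
move=> v; rewrite (le_trans (enorm_le_norm _))// -mulrA ler_wpM2l//.
have S0 : 0 <= \sum_i \sum_j `|A i j|.
  by apply: sumr_ge0 => i _; rewrite sumr_ge0.
rewrite -[`|_|]/(mx_norm _) mx_normrE; apply/bigmax_leP; split => /=.
  by rewrite mulr_ge0// enorm_ge0.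
case=> i j _ /=; rewrite mxE (le_trans (ler_norm_sum _ _ _))// mulr_suml.
apply: ler_sum => k _; rewrite normrM mulrC ler_pM//.
  by rewrite (bigD1 j)//= lerDl sumr_ge0.
by rewrite (ord1 i) coord_le_enorm.
Qed.

Lemma enorm_mulmx A v : enorm (v *m A) <= opnorm A * enorm v.
Proof.
have [C C0 AC] := opnorm_bounded A.
have [->|v0] := eqVneq v 0; first by rewrite mul0mx enorm0 mulr0.
have nv := enorm_gt0 v0.
rewrite -ler_pdivrMr// mulrC -[(enorm v)^-1]ger0_norm ?invr_ge0 ?enorm_ge0//.
rewrite -enormZ scalemxAl; apply: ub_le_sup.
  exists C => _ [w /= w1 <-]; rewrite (le_trans (AC _))//.
  by rewrite ler_piMr.
exists ((enorm v)^-1 *: v) => //=.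
by rewrite enormZ ger0_norm ?invr_ge0 ?enorm_ge0// mulVf ?lt0r_neq0.
Qed.

Lemma normr_quad_le A M u v : opnorm A <= M ->
  `|dotv (u *m A) v| <= M * enorm u * enorm v.
Proof.
move=> AM; rewrite (le_trans (normr_dotv_le _ _))// ler_wpM2r ?enorm_ge0//.
by rewrite (le_trans (enorm_mulmx _ _))// ler_wpM2r ?enorm_ge0.
Qed.

End EuclideanTheory.

(** * First-order expansion of a function with Lipschitz gradient *)

Section Descent.
Context {R : realType} {n : nat}.
Implicit Types (f : 'rV[R]_n -> R) (x y z v : 'rV[R]_n).

Lemma derive_gradient f x v :
  differentiable f x -> 'D_v f x = dotv (gradient f x) v.
Proof.
move=> df; rewrite deriveE// {1}[v]row_sum_delta linear_sum.
by apply: eq_bigr => i _; rewrite linearZ mulrC /gradient mxE deriveE.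
Qed.

(** Derivative of the restriction of a function to a line. *)
Lemma is_derive_line f z v (t : R) :
  differentiable f (z + t *: v) ->
  is_derive t 1 (fun s => f (z + s *: v)) (dotv (gradient f (z + t *: v)) v).
Proof.
move=> df; rewrite -derive_gradient//.
have E : (fun h : R => h^-1 *: (((fun s => f (z + s *: v)) \o shift t) (h *: 1)
             - f (z + t *: v)))
       = (fun h : R => h^-1 *: ((f \o shift (z + t *: v)) (h *: v)
             - f (z + t *: v))).
  apply/funext => h /=; congr (_ *: (f _ - _)).
  by rewrite /shift /= [h *: 1]mulr1 scalerDl addrCA.
have := @diff_derivable _ _ _ f _ v df.
by split; [rewrite /derivable E|rewrite /derive E].
Qed.

Lemma ecball_segment x r y z (t : R) : 0 <= t <= 1 ->
  ecball x r y -> ecball x r z -> ecball x r (z + t *: (y - z)).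
Proof.
move=> /andP[t0 t1]; rewrite /ecball /= => yr zr.
have -> : z + t *: (y - z) - x = t *: (y - x) + (1 - t) *: (z - x).
  by apply/rowP => i; rewrite !mxE; ring.
rewrite (le_trans (enormD _ _))// !enormZ !ger0_norm ?subr_ge0//; nra.
Qed.

Lemma first_order_error f x (O : set 'rV[R]_n) :
  open O -> O x -> continuously_differentiable_on f O ->
  locally_lipschitz_at (gradient f) x ->
  exists L r : R, [/\ 0 < L, 0 < r,
    forall y z, ecball x r y -> ecball x r z ->
      enorm (gradient f y - gradient f z) <= L * enorm (y - z) &
    forall y z, ecball x r y -> ecball x r z ->
      `|f y - f z - dotv (gradient f z) (y - z)| <= L * enorm (y - z) ^+ 2].
Proof.
move=> oO Ox fC1 [L [e [L0 e0 gL]]].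
have /nbhs_enormP[d d0 dO] : nbhs x O by exact: open_nbhs_nbhs.
have r0 : 0 < Num.min e (d / 2) by rewrite lt_min e0 divr_gt0.
have re y : ecball x (Num.min e (d / 2)) y -> ecball x e y.
  by rewrite /ecball /= le_min => /andP[].
have rO y : ecball x (Num.min e (d / 2)) y -> O y.
  rewrite /ecball /= le_min => /andP[_ yd].
  by apply: dO; rewrite (le_lt_trans yd)// ltr_pdivrMr//; lra.
exists L, (Num.min e (d / 2)); split=> // y z yr zr; first by apply: gL; exact: re.
pose p t := z + t *: (y - z).
have pr (t : R) : 0 <= t <= 1 -> ecball x (Num.min e (d / 2)) (p t).
  by move=> t01; exact: ecball_segment.
have dp (t : R) : 0 <= t <= 1 ->
    is_derive t 1 (fun s => f (p s)) (dotv (gradient f (p t)) (y - z)).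
  by move=> t01; apply: is_derive_line; have [] := fC1 _ (rO _ (pr _ t01)).
have [|||t] := @MVT_segment R (fun s => f (p s))
    (fun s => dotv (gradient f (p s)) (y - z)) 0 1.
- exact: ler01.
- by move=> t; rewrite in_itv/= => /andP[t0 t1]; apply: dp; rewrite !ltW.
- apply: derivable_within_continuous => t; rewrite in_itv/= => t01.
  by have [] := dp t t01.
rewrite in_itv/= => t01; rewrite /p scale1r scale0r addr0 subrKC subr0 mulr1.
rewrite -/(p t) => ->; rewrite -dotvBl (le_trans (normr_dotv_le _ _))//.
rewrite expr2 mulrA ler_wpM2r ?enorm_ge0//.
rewrite (le_trans (gL _ _ (re _ (pr _ t01)) (re _ zr)))// ler_wpM2l ?(ltW L0)//.
rewrite /p addrC addKr enormZ; case/andP: t01 => t0 t1.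
by rewrite ger0_norm// ler_piMl// enorm_ge0.
Qed.

End Descent.

(** * Minimizers of lower semicontinuous functions *)

Section LowerSemicontinuous.
Context {R : realType}.
Local Open Scope ereal_scope.

Lemma lsc_attains_min (X : topologicalType) (h : X -> \bar R) (K : set X) :
  lower_semicontinuous h -> (forall y, -oo < h y) -> compact K -> K !=set0 ->
  exists2 z, K z & forall y, K y -> h z <= h y.
Proof.
move=> lsc_h h_ninfty /compact_near_coveringP cK [y0 Ky0].
apply: contrapT => noMin.
have below z : K z -> exists2 y, K y & h y < h z.
  move=> Kz; apply: contrapT => Hz; apply: noMin; exists z => // y Ky.
  by rewrite leNgt; apply/negP => hyz; apply: Hz; exists y.
(* The filter of points of K whose value lies below that of some point of K. *)
pose G := filter_from K (fun y => [set w | K w /\ h w < h y]).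
have GF : Filter G.
  apply: filter_from_filter; first by exists y0.
  move=> y y' Ky Ky'; case: (leP (h y) (h y')) => hyy'.
    exists y => // w /= [Kw hw]; split=> //; split=> //.
    exact: lt_le_trans hyy'.
  exists y' => // w /= [Kw hw]; split=> //; split=> //.
  exact: lt_trans hyy'.
have [|y Ky Gy] := cK X G (fun w z => h w < h z) GF.
  move=> z Kz; have [y Ky hyz] := below z Kz.
  have /fineK hy : h y \is a fin_num.
    by rewrite fin_numElt h_ninfty (lt_le_trans hyz) ?leey.
  rewrite -hy in hyz; have [V zV hV] := lsc_h z _ hyz.
  exists (V, [set w | K w /\ h w < h y]); first by split=> //; exists y.
  by case=> z' w /= [Vz' [_ hw]]; rewrite (lt_trans hw)// -hy hV.
have [w Kw hwy] := below y Ky.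
by have := Gy w (conj Kw hwy) w Kw; rewrite ltxx.
Qed.

Lemma lscD_continuous (X : topologicalType) (q : X -> R) (h : X -> \bar R) :
  continuous q -> lower_semicontinuous h -> (forall y, -oo < h y) ->
  lower_semicontinuous (fun y => (q y)%:E + h y).
Proof.
move=> cq lsc_h h_ninfty x a; rewrite -lteBlDl// => ah.
(* A real number strictly between a - q x and h x. *)
have [c ac ch] : exists2 c : R, (a - q x < c)%R & c%:E < h x.
  move: ah; case: (h x) => [b| |].
  - rewrite -EFinB lte_fin => ab; exists ((a - q x + b) / 2)%R.
      by lra.
    by rewrite lte_fin; lra.
  - by move=> _; exists (a - q x + 1)%R; [lra|rewrite ltry].
  - by rewrite -EFinB.
have [V xV hV] := lsc_h x c ch.
have xq : \forall y \near x, (a - c < q y)%R.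
  by apply: (cq x (fun u => (a - c < u)%R)); apply: lt_nbhsr; lra.
exists (V `&` [set y | (a - c < q y)%R]); first exact: filterI.
move=> y [/hV cy /= qy].
have -> : a%:E = (a - c)%:E + c%:E by rewrite -EFinD subrK.
by rewrite lteD// lte_fin.
Qed.

End LowerSemicontinuous.

(** * Subgradients from quadratic minorants *)

Section Subgradient.
Context {R : realType} {n : nat}.
Implicit Types (g : 'rV[R]_n -> \bar R) (x v : 'rV[R]_n).
Local Open Scope ereal_scope.

Lemma regular_subdiff_quadratic g x v (C r : R) :
  g x \is a fin_num -> (0 <= C)%R -> (0 < r)%R ->
  (forall y, (enorm (y - x) < r)%R ->
     g x + (dotv v (y - x) - C * enorm (y - x) ^+ 2)%:E <= g y) ->
  regular_subdiff g x v.
Proof.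
move=> gx C0 r0 H; split=> //.
rewrite /limf_einf oppe_ge0; apply/lee_addgt0Pr => e e0; rewrite add0e.
have d0 : (0 < Num.min r (e / (C + 1)))%R.
  by rewrite lt_min r0 divr_gt0// ltr_wpDl.
apply: le_trans (ereal_inf_lbound _) _.
  exists [set y | y != x /\ (enorm (y - x) < Num.min r (e / (C + 1)))%R] => //.
  apply/nbhs_enormP; exists (Num.min r (e / (C + 1)))%R => //.
apply: ge_ereal_sup => _ [y /= [yx +] <-]; rewrite lt_min => /andP[yr ye].
have N0 : (0 < enorm (y - x))%R by rewrite enorm_gt0// subr_eq0.
have := H y yr; move: gx; case: (g x) => // a _.
have NV : (0 < (enorm (y - x))^-1)%R by rewrite invr_gt0.
case: (g y) => [b| |] //=.
  rewrite -!EFinD lee_fin => Hy. rewrite lee_fin.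
  rewrite -mulNr ler_pdivrMr//.
  move: ye; rewrite ltr_pdivlMr ?ltr_wpDl// => ye.
  have := ltW ye; rewrite -(ler_pM2l N0) => yee.
  have := sqr_ge0 (enorm (y - x)); nra.
by move=> _; rewrite !addye// gt0_mulye ?lte_fin//= leNye.
Qed.

End Subgradient.

(** * Concave functions lie below their tangents *)

Section ConcaveTangent.
Context {R : realType}.

Lemma concave_tangent (chi : R -> R) (eta s t : R) :
  convex_function `[0%R, eta]%classic (fun u => - chi u) ->
  derivable chi t 1 -> 0 <= s <= t -> t <= eta ->
  derive1 chi t * (t - s) <= chi t - chi s.
Proof.
move=> cvx dchi /andP[s0 st] te; move: st; rewrite le_eqVlt => /predU1P[->|st].
  by rewrite !subrr mulr0.
have h0 : 0 < t - s by rewrite subr_gt0.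
rewrite -ler_pdivlMr// leNgt; apply/negP => lt_slope.
have /cvgr_gt/(_ _ lt_slope) : (fun h : R => h^-1 *: (chi (h *: 1 + t) - chi t)) @ 0^' -->
    derive1 chi t.
  by rewrite derive1E; exact: dchi.
move=> /nbhs_ballP[d /= d0 dslope].
(* Convexity between t and s at the point t - h, for a small h > 0. *)
pose h := Num.min (d / 2) (t - s).
have h_gt0 : 0 < h by rewrite lt_min divr_gt0.
have hd : h < d by rewrite gt_min ltr_pdivrMr//; apply/orP; left; lra.
have hts : h <= t - s by rewrite ge_min lexx orbT.
have /= := dslope (- h).
rewrite -ball_normE /= sub0r opprK ger0_norm ?(ltW h_gt0)// => /(_ hd).
rewrite oppr_eq0 gt_eqF// => /(_ isT); apply/negP; rewrite -leNgt.
have l01 : 0 <= h / (t - s) <= 1.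
  by rewrite divr_ge0 ?(ltW h_gt0) ?(ltW h0)//= ler_pdivrMr// mul1r.
have /andP[l0 l1] := l01.
have := cvx (Itv01 l0 l1) s t; rewrite !inE/= !in_itv/=.
rewrite s0 (ltW (lt_le_trans st te)) te (le_trans s0 (ltW st)) => /(_ isT isT).
move=> cvx_h; have {cvx_h} : - chi (h / (t - s) * s + (1 - h / (t - s)) * t) <=
    h / (t - s) * - chi s + (1 - h / (t - s)) * - chi t := cvx_h.
have -> : h / (t - s) * s + (1 - h / (t - s)) * t = - h + t.
  by field; rewrite gt_eqF.
move=> cvx_h.
rewrite [(- h)%:A]mulr1 invrN scaleNr -scalerN -ler_pdivlMl ?invr_gt0// invrK.
by move: cvx_h; set c := chi (- h + t); lra.
Qed.

End ConcaveTangent.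

(** * Convergence of descent sequences under the Kurdyka-Lojasiewicz property *)

Section KLConvergence.
Context {R : realType} {n : nat}.

Lemma desingularization_small (eta : R) (chi : R -> R) (d : R) :
  0 < eta -> desingularization eta chi -> 0 < d ->
  exists2 tau, 0 < tau & forall t, 0 <= t -> t < tau -> chi t < d.
Proof.
move=> eta0 [[chi_cont _] _ _ chi0 _] d0.
have [_ + _] := (continuous_within_itvP _ eta0).1 chi_cont.
rewrite chi0 => /cvgr_lt/(_ d d0) /nbhs_ballP[tau /= tau0 H].
exists tau => // t; rewrite le_eqVlt => /predU1P[<-|t0] tt; first by rewrite chi0.
by apply: H => //; rewrite -ball_normE /= sub0r normrN gtr0_norm.
Qed.

(** The sequence either stays put or takes a step whose decrease of [F] is at
    least quadratic in its length and which, near [xs], ends at a point with a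
    subgradient at most proportional to that length.  The proof keeps the
    sum of the distance to [xs], of a number [e] (the length of the last step,
    once one has been taken) and of [b / a] times the desingularized gap
    [chi (F - F xs)] below any prescribed bound. *)
Lemma KL_convergence (F : 'rV[R]_n -> \bar R) (x : nat -> 'rV[R]_n)
    (xs : 'rV[R]_n) (Fr : nat -> R) (Fs a b rho : R) :
  0 < a -> 0 < b -> 0 < rho -> KL_property F xs ->
  F xs = Fs%:E -> (forall k, F (x k) = (Fr k)%:E) -> (forall k, Fs <= Fr k) ->
  (forall k, x k.+1 = x k \/
     Fr k.+1 + a * enorm (x k.+1 - x k) ^+ 2 <= Fr k /\
     (enorm (x k - xs) < rho -> enorm (x k.+1 - xs) < rho ->
      exists2 v, limiting_subdiff F (x k.+1) v &
        enorm v <= b * enorm (x k.+1 - x k))) ->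
  (forall d, 0 < d -> exists k e, [/\ enorm (x k - xs) < d, Fr k < Fs + d,
     0 <= e < d &
     exists2 v, limiting_subdiff F (x k) v & enorm v <= b * e]) ->
  x @ \oo --> xs.
Proof.
move=> a0 b0 rho0 [_ [eta [U [chi [eta0 /nbhs_enormP[rU rU0 UrU] chiD KL]]]]].
move=> FxsE FxE FsFr step acc.
have [[_ chi_concave] chi_ge0 chi_deriv chi0 chi_pos] := chiD.
apply: cvg_enorm => d0 d0_gt0.
have [dd [dd_gt0 dd_d0 dd_rho dd_rU]] :
    exists dd, [/\ 0 < dd, dd <= d0, dd <= rho & dd <= rU].
  exists (Num.min d0 (Num.min rho rU)).
  by rewrite !lt_min d0_gt0 rho0 rU0 !ge_min !lexx !orbT.
set c := b / a; have c0 : 0 < c by rewrite divr_gt0.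
pose Inv k := exists e, [/\ 0 <= e,
  enorm (x k - xs) + e + c * chi (Fr k - Fs) < dd, Fr k - Fs < eta &
  exists2 v, limiting_subdiff F (x k) v & enorm v <= b * e].
have chi_ge0' t : 0 <= t < eta -> 0 <= chi t.
  by move=> /andP[t0 t1]; apply: chi_ge0; rewrite in_itv/= t0 ltW.
have Inv_start : exists k, Inv k.
  have d3 : 0 < dd / 3 / c by rewrite !divr_gt0.
  have [tau tau0 chi_tau] := desingularization_small eta0 chiD d3.
  have m0 : 0 < Num.min (dd / 3) (Num.min tau eta).
    by rewrite !lt_min tau0 eta0 divr_gt0.
  have [k [e [+ + /andP[e0 +] sub]]] := acc _ m0.
  rewrite -ltrBlDl !lt_min => /andP[xk _] /and3P[_ Ftau Feta] /andP[ee _].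
  exists k, e; split=> //.
  have := chi_tau _ _ Ftau; rewrite subr_ge0 => /(_ (FsFr k)).
  rewrite ltr_pdivlMr// mulrC; lra.
have Inv_next k : Inv k -> Inv k.+1.
  case=> e [e0 pot Feta [v vF vb]].
  have gap0 : 0 <= Fr k - Fs by rewrite subr_ge0.
  have chik : 0 <= chi (Fr k - Fs) by rewrite chi_ge0'// gap0.
  have same : x k.+1 = x k -> Inv k.+1.
    move=> E; have FE : Fr k.+1 = Fr k by apply: EFin_inj; rewrite -!FxE E.
    by exists e; rewrite /Inv E FE; split=> //; exists v.
  have [E|[decr subg]] := step k; first exact: same.
  set s := enorm (x k.+1 - x k) in decr subg *.
  have s0 : 0 <= s := enorm_ge0 _.
  have s2 : 0 <= a * s ^+ 2 by rewrite mulr_ge0 ?sqr_ge0// ltW.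
  have FrS : Fr k.+1 <= Fr k by lra.
  have xk_close : enorm (x k - xs) < dd.
    by have := mulr_ge0 (ltW c0) chik; lra.
  (* A value equal to its lower bound [Fs] forces a step of length 0. *)
  have [gap_eq0|gap_neq0] := eqVneq (Fr k - Fs) 0.
    apply: same; apply/eqP; rewrite -subr_eq0; apply/eqP/enorm_eq0/eqP.
    rewrite -sqrf_eq0 eq_le sqr_ge0 andbT -(pmulr_rle0 _ a0) -/s.
    by have := FsFr k.+1; lra.
  have gap_gt0 : 0 < Fr k - Fs by rewrite lt_neqAle eq_sym gap_neq0.
  have gap_in : Fr k - Fs \in `]0, eta[ by rewrite in_itv/= gap_gt0.
  have dchi0 := chi_pos _ gap_in; have [dchi _] := chi_deriv _ gap_in.
  have KLk : 1 <= derive1 chi (Fr k - Fs) * (b * e).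
    have := KL (x k); rewrite FxE FxsE -EFinB -EFinD !lte_fin -subr_gt0 -ltrBlDl.
    move=> /(_ (UrU _ (lt_le_trans xk_close dd_rU)) gap_gt0 Feta).
    rewrite /= -lee_fin EFinM; move/le_trans; apply.
    apply: lee_wpmul2l; first by rewrite lee_fin ltW.
    apply: (@le_trans _ _ (enorm v)%:E); last by rewrite lee_fin.
    by apply: ereal_inf_lbound; exists v => //; rewrite sub0r enormN.
  have gapS0 : 0 <= Fr k.+1 - Fs by rewrite subr_ge0.
  have tangent : derive1 chi (Fr k - Fs) * (Fr k - Fr k.+1) <=
      chi (Fr k - Fs) - chi (Fr k.+1 - Fs).
    have -> : Fr k - Fr k.+1 = (Fr k - Fs) - (Fr k.+1 - Fs) by ring.
    apply: (concave_tangent chi_concave dchi); last exact: ltW.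
    by rewrite gapS0 lerB.
  set D := chi (Fr k - Fs) - chi (Fr k.+1 - Fs) in tangent.
  (* s ^ 2 <= e * c * D, whence 2 s <= e + c D by the mean inequality. *)
  have sq : s ^+ 2 <= e * (c * D).
    have H1 : derive1 chi (Fr k - Fs) * (a * s ^+ 2) <= D.
      by rewrite (le_trans _ tangent)// ler_pM2l//; lra.
    have -> : e * (c * D) = b * e * D / a by rewrite /c; ring.
    rewrite ler_pdivlMr// [_ * a]mulrC.
    apply: le_trans (ler_wpM2l _ H1); last by rewrite mulr_ge0// ltW.
    by rewrite [leRHS]mulrA ler_peMl// mulrC.
  have cD0 : 0 <= c * D.
    apply: mulr_ge0; first exact: ltW.
    rewrite (le_trans _ tangent)// mulr_ge0 ?(ltW dchi0)//; lra.
  have mean : 2 * s <= e + c * D.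
    rewrite -(ler_pXn2r (ltn0Sn 1)) ?nnegrE ?mulr_ge0 ?addr_ge0//.
    have := sqr_ge0 (e - c * D); nra.
  have potS : enorm (x k.+1 - xs) + s + c * chi (Fr k.+1 - Fs) < dd.
    have := enorm_triangle (x k) (x k.+1) xs; rewrite -/s.
    by move: mean pot; rewrite /D mulrBr; lra.
  have FetaS : Fr k.+1 - Fs < eta by lra.
  have chiS : 0 <= chi (Fr k.+1 - Fs) by rewrite chi_ge0'// gapS0.
  exists s; split=> //; apply: subg; first exact: lt_le_trans dd_rho.
  by rewrite (lt_le_trans _ dd_rho)//; have := mulr_ge0 (ltW c0) chiS; lra.
have [K InvK] := Inv_start.
exists K => // k /= /subnK <-.
have [e [e0 pot Feta _]] : Inv (k - K + K)%N.
  by elim: (k - K)%N => [//|j IH]; rewrite addSn; exact: Inv_next.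
have chik : 0 <= chi (Fr (k - K + K)%N - Fs) by rewrite chi_ge0'// subr_ge0 FsFr.
by rewrite (lt_le_trans _ dd_d0)//; have := mulr_ge0 (ltW c0) chik; lra.
Qed.

End KLConvergence.

(** * The regularized subproblem *)

Section Subproblem.
Context {R : realType} {n : nat}.
Context (f : 'rV[R]_n -> R) (phi : 'rV[R]_n -> \bar R).
Hypothesis phi_ninfty : no_ninfty phi.
Implicit Types (p y z : 'rV[R]_n) (B : 'M[R]_n) (mu M : R).

(** The increment of the smooth part of the regularized model at [p]. *)
Definition quad_increment p B mu y : R :=
  dotv (gradient f p) (y - p) + 2^-1 * dotv ((y - p) *m B) (y - p)
  + mu / 2 * enorm (y - p) ^+ 2.

Lemma effdom_fineK y : effdom phi y -> (fine (phi y))%:E = phi y.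
Proof. by move=> ydom; rewrite fineK// fin_numElt phi_ninfty. Qed.

Lemma objective_fineE y :
  effdom phi y -> objective f phi y = (f y + fine (phi y))%:E.
Proof. by move=> /effdom_fineK yE; rewrite /objective -yE. Qed.

Lemma reg_modelE p B mu y :
  reg_model f phi p B mu y = ((f p + quad_increment p B mu y)%:E + phi y)%E.
Proof.
rewrite /reg_model /model /quad_increment addeAC -EFinD.
by congr (_%:E + _)%E; rewrite !addrA.
Qed.

Lemma quad_increment0 p B mu : quad_increment p B mu p = 0.
Proof. by rewrite /quad_increment subrr !dotv0 enorm0 expr0n !mulr0 !addr0. Qed.

Lemma quad_increment_ge p B mu M y : opnorm B <= M ->
  - (enorm (gradient f p) * enorm (y - p)) + (mu - M) / 2 * enorm (y - p) ^+ 2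
    <= quad_increment p B mu y.
Proof.
move=> BM; rewrite /quad_increment.
have := normr_dotv_le (gradient f p) (y - p).
have := normr_quad_le (y - p) (y - p) BM.
rewrite !ler_norml => /andP[+ _] /andP[+ _]; rewrite -mulrA -expr2; lra.
Qed.

Lemma quad_increment_le p B mu M y : opnorm B <= M ->
  quad_increment p B mu y <=
    enorm (gradient f p) * enorm (y - p) + (mu + M) / 2 * enorm (y - p) ^+ 2.
Proof.
move=> BM; rewrite /quad_increment.
have := normr_dotv_le (gradient f p) (y - p).
have := normr_quad_le (y - p) (y - p) BM.
rewrite !ler_norml => /andP[_ +] /andP[_ +]; rewrite -mulrA -expr2; lra.
Qed.

(** Exact expansion of the model around another point. *)
Lemma quad_increment_expand p B mu z y : B^T = B ->
  quad_increment p B mu y = quad_increment p B mu z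
    + dotv (gradient f p + (z - p) *m B + mu *: (z - p)) (y - z)
    + 2^-1 * dotv ((y - z) *m B) (y - z) + mu / 2 * enorm (y - z) ^+ 2.
Proof.
move=> sB; rewrite /quad_increment.
have -> : y - p = (z - p) + (y - z) by rewrite [RHS]addrC subrKA.
move: (z - p) (y - z) => d h.
rewrite !enorm_sqr mulmxDl !dotvDl !dotvDr !dotvZl.
rewrite (dotv_mulmx_sym h d sB) (dotvC h d); lra.
Qed.

Lemma continuous_dotv (u v : 'rV[R]_n -> 'rV[R]_n) :
  continuous u -> continuous v -> continuous (fun y => dotv (u y) (v y)).
Proof.
move=> cu cv; rewrite /dotv; apply: continuous_big; first exact: add_continuous.
have coord (w : 'rV[R]_n -> 'rV[R]_n) i :
    continuous w -> continuous (fun y => w y 0 i).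
  move=> cw y; apply: (@continuous_comp _ _ _ w (fun z : 'rV[R]_n => z 0 i)).
    exact: cw.
  exact: coord_continuous.
by move=> i _ y; exact: (continuousM (coord u i cu y) (coord v i cv y)).
Qed.

Lemma continuous_mulmx B : continuous (fun v : 'rV[R]_n => v *m B).
Proof.
move=> v U /nbhs_enormP[d d0 dU]; have [C C0 BC] := opnorm_bounded B.
apply/nbhs_enormP; exists (d / (C + 1)); first by rewrite divr_gt0// ltr_wpDl.
move=> w; rewrite ltr_pdivlMr ?ltr_wpDl// => wv; apply: dU; rewrite -mulmxBl.
have := BC (w - v); have := enorm_ge0 (w - v); lra.
Qed.

Lemma continuous_quad_increment p B mu : continuous (quad_increment p B mu).
Proof.
have cB : continuous (fun y : 'rV[R]_n => y - p).
  by move=> y; apply: continuousB; [exact: cvg_id|exact: cst_continuous].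
have cBB : continuous (fun y : 'rV[R]_n => (y - p) *m B).
  move=> y; apply: (@continuous_comp _ _ _ (fun y => y - p) (fun v => v *m B)).
    exact: cB.
  exact: continuous_mulmx.
have cN := @continuous_enorm_sub R n p.
have cM (s t : 'rV[R]_n -> R) : continuous s -> continuous t ->
    continuous (fun y => s y * t y).
  by move=> cs ct y; exact: (continuousM (cs y) (ct y)).
have c1 : continuous (fun y => dotv (gradient f p) (y - p)).
  by apply: continuous_dotv => //; exact: cst_continuous.
have c2 : continuous (fun y => 2^-1 * dotv ((y - p) *m B) (y - p)).
  exact: cM (@cst_continuous _ _ _) (continuous_dotv cBB cB).
have c3 : continuous (fun y => mu / 2 * enorm (y - p) ^+ 2).
  exact: cM (@cst_continuous _ _ _) (cM _ _ cN cN).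
by move=> y; exact: (continuousD (continuousD (c1 y) (c2 y)) (c3 y)).
Qed.

Lemma minimizer_dom p B mu z : effdom phi p ->
  global_minimizer (reg_model f phi p B mu) z -> effdom phi z.
Proof.
move=> pdom /(_ p); rewrite !reg_modelE quad_increment0 addr0 -(effdom_fineK pdom).
rewrite -EFinD /effdom /= => H; rewrite ltey; apply/eqP => zoo.
by move: H; rewrite zoo addey.
Qed.

Lemma minimizer_le p B mu z y : effdom phi z -> effdom phi y ->
  global_minimizer (reg_model f phi p B mu) z ->
  quad_increment p B mu z + fine (phi z) <= quad_increment p B mu y + fine (phi y).
Proof.
move=> zdom ydom /(_ y); rewrite !reg_modelE -(effdom_fineK zdom) -(effdom_fineK ydom).
by rewrite -!EFinD lee_fin -!addrA lerD2l.
Qed.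

(** A large regularization parameter confines the sublevel set of the
    regularized model through [p] to a small ball around [p]; the bound is
    uniform over [p], [B] and [mu] subject to the stated estimates. *)
Lemma sublevel_localized (M rho kappa c D G P : R) (xb : 'rV[R]_n) p B mu y :
  0 <= kappa -> 0 < rho -> opnorm B <= M ->
  (forall w, effdom phi w -> c - kappa * enorm (w - xb) ^+ 2 <= fine (phi w)) ->
  enorm (p - xb) <= D -> enorm (gradient f p) <= G -> fine (phi p) <= P ->
  let Q := P - c + G ^+ 2 / 2 + 2 * kappa * D ^+ 2 in
  M / 2 + 1 / 2 + 2 * kappa + (`|Q| + 1) / rho ^+ 2 <= mu / 2 ->
  effdom phi y -> quad_increment p B mu y + fine (phi y) <= fine (phi p) ->
  enorm (y - p) <= rho.
Proof.
move=> kappa0 rho0 BM prox pD gG pP Q mu_large ydom yp.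
have := quad_increment_ge p mu y BM; have := prox y ydom.
have := enorm_triangle p y xb; have := enorm_ge0 (y - p).
have := enorm_ge0 (p - xb); have := enorm_ge0 (gradient f p).
have := enorm_ge0 (y - xb).
move: (enorm (y - p)) (enorm (gradient f p)) (enorm (p - xb)) (enorm (y - xb))
  gG pD => s g d e gG dD e0 g0 d0 s0 eds phiy incr.
have e2 : e ^+ 2 <= 2 * s ^+ 2 + 2 * D ^+ 2.
  have : e ^+ 2 <= (s + D) ^+ 2 by rewrite lerXn2r ?nnegrE; lra.
  by have := sqr_ge0 (s - D); lra.
have gs : g * s <= G ^+ 2 / 2 + s ^+ 2 / 2.
  have : g * s <= G * s by rewrite ler_wpM2r.
  by have := sqr_ge0 (G - s); lra.
have ke2 := ler_wpM2l kappa0 e2.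
have sQ : (mu / 2 - M / 2 - 1 / 2 - 2 * kappa) * s ^+ 2 <= Q.
  by rewrite /Q; lra.
have s2 := sqr_ge0 s.
have rho2 : 0 < rho ^+ 2 by rewrite exprn_gt0.
have coef : (`|Q| + 1) / rho ^+ 2 <= mu / 2 - M / 2 - 1 / 2 - 2 * kappa by lra.
have : (`|Q| + 1) / rho ^+ 2 * s ^+ 2 <= `|Q| + 1.
  have := ler_wpM2r s2 coef; have := ler_norm Q; lra.
rewrite mulrAC ler_pdivrMr// ler_pM2l ?ltr_wpDl// => srho.
by rewrite -(ler_pXn2r (ltn0Sn 1)) ?nnegrE// ltW.
Qed.

Lemma minimizer_exists (rho : R) p B mu :
  lower_semicontinuous phi -> 0 < rho -> effdom phi p ->
  (forall y, effdom phi y ->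
     quad_increment p B mu y + fine (phi y) <= fine (phi p) ->
     enorm (y - p) <= rho) ->
  exists z, global_minimizer (reg_model f phi p B mu) z.
Proof.
move=> phi_lsc rho0 pdom loc.
have Kp : ecball p rho p by rewrite /ecball /= subrr enorm0 ltW.
have [||||z Kz zmin] := @lsc_attains_min R _ (reg_model f phi p B mu)
    (ecball p rho).
- rewrite (_ : reg_model _ _ _ _ _ =
      (fun y => ((f p + quad_increment p B mu y)%:E + phi y)%E)).
    apply: lscD_continuous => // y.
    exact: (continuousD (@cst_continuous _ _ (f p) y)
                       (@continuous_quad_increment p B mu y)).
  by apply/funext => y; exact: reg_modelE.
- by move=> y; rewrite reg_modelE; case: (phi y) (phi_ninfty y) => // a _; rewrite ltNyr.
- exact: ecball_compact.
- by exists p.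
exists z => y; have [Ky|nKy] := pselect (ecball p rho y); first exact: zmin.
apply: le_trans (zmin p Kp) _; rewrite !reg_modelE quad_increment0 addr0.
have [ydom|] := pselect (effdom phi y); last first.
  move=> /negP; rewrite /effdom /= ltey negbK => /eqP ->.
  by rewrite addey ?leey.
rewrite -(effdom_fineK pdom) -(effdom_fineK ydom) -!EFinD lee_fin -addrA lerD2l.
by rewrite leNgt; apply/negP => /ltW/(loc y ydom).
Qed.

(** ** Estimates on a ball where the gradient is Lipschitz *)

Section Local.
Context (xs : 'rV[R]_n) (L r : R).
Hypothesis gradL : forall y z, ecball xs r y -> ecball xs r z ->
  enorm (gradient f y - gradient f z) <= L * enorm (y - z).
Hypothesis errL : forall y z, ecball xs r y -> ecball xs r z ->
  `|f y - f z - dotv (gradient f z) (y - z)| <= L * enorm (y - z) ^+ 2.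

(** Decrease predicted by the model versus actual decrease of the objective:
    the step passes the acceptance test once [mu] is large. *)
Lemma sufficient_decrease M c1 p B mu z :
  opnorm B <= M -> 0 < L -> 0 < M -> 0 < c1 < 1 ->
  2 * (L + M) / (1 - c1) <= mu ->
  ecball xs r p -> ecball xs r z -> effdom phi p -> effdom phi z ->
  global_minimizer (reg_model f phi p B mu) z ->
  (c1%:E * (objective f phi p - model f phi p B z)
     <= objective f phi p - objective f phi z)%E.
Proof.
move=> BM L0 M0 /andP[c0 c1_lt1] mu_large pr zr pdom zdom zmin.
rewrite /model -(effdom_fineK zdom) !objective_fineE// -!(EFinD,EFinN,EFinM).
rewrite lee_fin.
have := minimizer_le zdom pdom zmin; rewrite quad_increment0 /quad_increment.
have := errL zr pr; rewrite ler_norml => /andP[_].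
have := normr_quad_le (z - p) (z - p) BM; rewrite ler_norml => /andP[+ _].
rewrite -mulrA -expr2; have := sqr_ge0 (enorm (z - p)).
move: (dotv _ _) (dotv _ _) (enorm _ ^+ 2) (fine (phi z)) (fine (phi p)) (f p) (f z).
move=> gd q s a b fp fz s0 qs err zp.
move: mu_large; rewrite ler_pdivrMr ?subr_gt0// => /(ler_wpM2r s0); nra.
Qed.

Lemma subgradient_step M p B mu z :
  0 < L -> 0 < r -> 0 <= M -> 0 <= mu -> opnorm B <= M -> B^T = B ->
  effdom phi p ->
  enorm (p - xs) <= r / 2 -> enorm (z - xs) <= r / 2 ->
  global_minimizer (reg_model f phi p B mu) z ->
  exists2 v, limiting_subdiff (objective f phi) z v &
    enorm v <= (L + M + mu) * enorm (z - p).
Proof.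
move=> L0 r0 M0 mu0 BM sB pdom pr zr zmin.
have zdom := minimizer_dom pdom zmin.
have r2 t : t <= r / 2 -> t <= r by lra.
have Kp : ecball xs r p by exact: r2.
have Kz : ecball xs r z by exact: r2.
pose v := gradient f z - gradient f p - (z - p) *m B - mu *: (z - p).
have reg_v : regular_subdiff (objective f phi) z v.
  apply: (@regular_subdiff_quadratic _ _ _ _ _ (L + (M + mu) / 2) (r / 2)).
  - by rewrite objective_fineE.
  - by lra.
  - by lra.
  move=> y yz; have [ydom|] := pselect (effdom phi y); last first.
    move=> /negP; rewrite /effdom /= ltey negbK => /eqP yoo.
    by rewrite /objective yoo addey ?leey.
  rewrite !objective_fineE// -EFinD lee_fin.
  have Ky : ecball xs r y.
    by rewrite /ecball /=; have := enorm_triangle z y xs; lra.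
  have := minimizer_le zdom ydom zmin.
  rewrite (quad_increment_expand p mu z y sB).
  have := errL Ky Kz; rewrite ler_norml => /andP[+ _].
  have := normr_quad_le (y - z) (y - z) BM; rewrite ler_norml => /andP[_ +].
  rewrite -mulrA -expr2 /v 3!dotvBl !dotvDl; lra.
exists v.
  case: (reg_v) => zfin _; split=> //.
  by exists (fun=> z), (fun=> v); split=> //; exact: cvg_cst.
rewrite /v; set d := z - p.
have := enormD (gradient f z - gradient f p - d *m B) (- (mu *: d)).
have := enormD (gradient f z - gradient f p) (- (d *m B)).
have := gradL Kz Kp; have := enorm_mulmx B d.
have := ler_wpM2r (enorm_ge0 d) BM.
rewrite !enormN enormZ ger0_norm// -/d; lra.
Qed.

(** The objective value after a short step from near [xs] is hardly larger
    than its value at [xs]: the step competes with [xs] in the subproblem. *)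
Lemma value_after_step M G mubar p B mu z tau :
  0 < L -> 0 <= M -> 0 <= mu <= mubar -> opnorm B <= M ->
  effdom phi xs -> effdom phi p -> ecball xs r xs ->
  ecball xs r p -> ecball xs r z ->
  enorm (gradient f xs) <= G -> enorm (gradient f p) <= G ->
  enorm (p - xs) <= tau -> enorm (z - p) <= tau -> tau <= 1 ->
  global_minimizer (reg_model f phi p B mu) z ->
  f z + fine (phi z) <= f xs + fine (phi xs) + (4 * G + M + mubar + 4 * L) * tau.
Proof.
move=> L0 M0 /andP[mu0 mub] BM xdom pdom Kxs Kp Kz gxs gp pt zt t1 zmin.
have zdom := minimizer_dom pdom zmin.
have zxs : enorm (z - xs) <= 2 * tau by have := enorm_triangle p z xs; lra.
have := minimizer_le zdom xdom zmin.
have := quad_increment_ge p mu z BM; have := quad_increment_le p mu xs BM.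
have := errL Kz Kxs; rewrite ler_norml => /andP[_].
have := dotv_le (gradient f xs) (z - xs).
rewrite (enormB xs p).
have := enorm_ge0 (p - xs); have := enorm_ge0 (z - p); have := enorm_ge0 (z - xs).
have := enorm_ge0 (gradient f xs); have := enorm_ge0 (gradient f p).
move: (dotv _ _) (enorm (p - xs)) (enorm (z - p)) (enorm (z - xs))
  (enorm (gradient f xs)) (enorm (gradient f p)) gxs gp pt zt zxs.
move=> d t s e g g' gG g'G tt st et g'0 g0 e0 s0 t0 dle err qxs qz zp.
have sq u c : 0 <= u -> u <= c * tau -> 0 <= c -> u ^+ 2 <= c ^+ 2 * tau.
  move=> u0 uc c0; have : u ^+ 2 <= (c * tau) ^+ 2.
    by rewrite lerXn2r ?nnegrE//; lra.
  rewrite exprMn => /le_trans; apply; rewrite ler_wpM2l ?sqr_ge0//.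
  by rewrite expr2 ler_piMr//; lra.
have t2 := sq t 1 t0 ltac:(lra) ler01.
have s2 := sq s 1 s0 ltac:(lra) ler01.
have e2 := sq e 2 e0 et ltac:(lra).
have tau0 : 0 <= tau by lra.
have pG u c : 0 <= u -> u <= G -> forall w, 0 <= w -> w <= c * tau -> u * w <= G * (c * tau).
  by move=> u0 uG w w0 wc; apply: ler_pM.
have m1 : g * e <= G * (2 * tau) by exact: pG.
have m2 : g' * t <= G * (1 * tau) by apply: pG => //; lra.
have m3 : g' * s <= G * (1 * tau) by apply: pG => //; lra.
have Mm : 0 <= (mu + M) / 2 by lra.
have m4 := ler_wpM2l Mm t2.
have m5 : (M - mu) / 2 * s ^+ 2 <= M / 2 * tau.
  have := mulr_ge0 mu0 (sqr_ge0 s); have := ler_wpM2l M0 s2; lra.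
have m6 := ler_wpM2l (ltW L0) e2.
have m7 := ler_wpM2r tau0 mub.
have m8 := mulr_ge0 mu0 tau0.
lra.
Qed.

End Local.
End Subproblem.

(** * Runs of the algorithm *)

Section Run.
Context {R : realType} {n : nat}.
Context (f : 'rV[R]_n -> R) (phi : 'rV[R]_n -> \bar R).
Hypothesis phi_ninfty : no_ninfty phi.
Context (c1 sigma2 mumin mumax : R).
Hypotheses (c1_bounds : 0 < c1 < 1) (sigma2_gt1 : 1 < sigma2)
  (mumin_gt0 : 0 < mumin).
Context (x : nat -> 'rV[R]_n) (B : nat -> 'M[R]_n) (mu : nat -> R)
  (xhat : nat -> option 'rV[R]_n).
Hypothesis run : algorithm_run f phi c1 sigma2 mumin mumax x B mu xhat.

Local Notation success := (successful f phi c1 x B xhat).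
Local Notation minimizer k :=
  (global_minimizer (reg_model f phi (x k) (B k) (mu k))).

(** The finite objective value at the [k]-th iterate. *)
Definition run_value k : R := f (x k) + fine (phi (x k)).

Lemma success_minimizer k : success k -> minimizer k (x k.+1).
Proof. by move=> /(run_success run)[+ _ _]; exact: (run_found run). Qed.

Lemma run_dom k : effdom phi (x k).
Proof.
elim: k => [|k IH]; first exact: run_x0 run.
have [Sk|/(run_failure run)[-> _ _]//] := pselect (success k).
exact: minimizer_dom (success_minimizer Sk).
Qed.

Lemma run_sym k : (B k)^T = B k.
Proof.
elim: k => [|k IH]; first exact: run_B0 run.
by have [/(run_success run)[]|/(run_failure run)[_ -> _]] := pselect (success k).
Qed.

Lemma run_mu_ge k : mumin <= mu k.
Proof.
elim: k => [|k IH]; first by have /andP[] := run_mu0 run.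
have [/(run_success run)[_ _ /andP[]]//|/(run_failure run)[_ _ ->]] :=
  pselect (success k).
by rewrite (le_trans IH)// ler_peMl ?ltW// (lt_le_trans mumin_gt0 IH).
Qed.

Lemma run_valueE k : objective f phi (x k) = (run_value k)%:E.
Proof. by rewrite objective_fineE//; exact: run_dom. Qed.

Lemma success_decrease k : success k ->
  run_value k.+1 + c1 * mumin / 2 * enorm (x k.+1 - x k) ^+ 2 <= run_value k.
Proof.
move=> Sk; have [z xz] := Sk; have [xS _ _] := run_success run Sk.
move: xz; rewrite xS => -[<-].
have zdom := run_dom k.+1; have pdom := run_dom k.
have := minimizer_le phi_ninfty zdom pdom (success_minimizer Sk).
rewrite quad_increment0 /quad_increment /ared /pred_red /model !run_valueE.
rewrite -(effdom_fineK phi_ninfty zdom) -!(EFinD,EFinN,EFinM) lee_fin.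
rewrite /run_value; have := run_mu_ge k; have := sqr_ge0 (enorm (x k.+1 - x k)).
case/andP: c1_bounds => c0 _.
move: (dotv _ _) (dotv _ _) (enorm _ ^+ 2) => q d s s0 mk.
move=> le_model accept.
have H : mumin / 2 * s <= mu k / 2 * s by rewrite ler_wpM2r//; lra.
have /(ler_wpM2l (ltW c0)) : mumin / 2 * s <=
    fine (phi (x k)) - fine (phi (x k.+1)) - d - 2^-1 * q by lra.
by lra.
Qed.

Lemma run_value_nonincreasing j k : (j <= k)%N -> run_value k <= run_value j.
Proof.
move=> /subnK <-; elim: (k - j)%N => [|i IH]; first by rewrite add0n.
rewrite addSn (le_trans _ IH)//.
have [Sk|nSk] := pselect (success (i + j)%N).
  apply: le_trans (success_decrease Sk); rewrite lerDl.
  by rewrite mulr_ge0 ?sqr_ge0// divr_ge0// mulr_ge0// ltW//; case/andP: c1_bounds.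
by rewrite /run_value; have [-> _ _] := run_failure run nSk.
Qed.

Section NearPoint.
Context (xs : 'rV[R]_n) (L r M : R).
Hypotheses (L0 : 0 < L) (r0 : 0 < r) (M0 : 0 < M).
Hypothesis gradL : forall y z, ecball xs r y -> ecball xs r z ->
  enorm (gradient f y - gradient f z) <= L * enorm (y - z).
Hypothesis errL : forall y z, ecball xs r y -> ecball xs r z ->
  `|f y - f z - dotv (gradient f z) (y - z)| <= L * enorm (y - z) ^+ 2.
Hypothesis BM : forall k, opnorm (B k) <= M.

Let Kxs : ecball xs r xs.
Proof. by rewrite /ecball /= subrr enorm0 ltW. Qed.

Let G := enorm (gradient f xs) + L * r.

Lemma gradient_bound y : ecball xs r y -> enorm (gradient f y) <= G.
Proof.
move=> Ky; have := gradL Ky Kxs; have := ler_wpM2l (ltW L0) Ky.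
have := enormD (gradient f y - gradient f xs) (gradient f xs).
by rewrite subrK /G; lra.
Qed.

Let G_ge0 : 0 <= G.
Proof. by rewrite (le_trans (enorm_ge0 _) (gradient_bound Kxs)). Qed.

(** The regularization parameter stays bounded while the iterates are near
    [xs]: close to [xs], a large parameter makes an iteration successful. *)
Lemma mu_bounded_near : lower_semicontinuous phi -> prox_bounded phi ->
  exists mubar, forall k, enorm (x k - xs) <= r / 2 -> mu k <= mubar.
Proof.
move=> phi_lsc [gamma [xb [gamma0 prox]]].
have [r_gt0 L_gt0 M_gt0] : [/\ 0 < r, 0 < L & 0 < M] by [].
set kappa := (2 * gamma)^-1 in prox.
have kappa0 : 0 <= kappa by rewrite invr_ge0 mulr_ge0// ltW.
have [c phi_ge] : exists c : R, forall w, effdom phi w ->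
    c - kappa * enorm (w - xb) ^+ 2 <= fine (phi w).
  set I := ereal_inf _ in prox.
  have [c cI] : exists c : R, (c%:E <= I)%E.
    by case: I prox => [c _|_|//]; [exists c|exists 0; rewrite leey].
  exists c => w wdom; rewrite lerBlDr -lee_fin EFinD (effdom_fineK phi_ninfty)//.
  by apply: (le_trans cI); apply: ereal_inf_lbound; exists w.
(* Near [xs], [P] bounds [phi (x k)] and [D] bounds the distance to [xb]; above
   [mu1] the minimizer is close to [x k], above [mu2] it passes the test. *)
pose P := run_value 0 - f xs + G * r + L * r ^+ 2.
pose D := r + enorm (xs - xb).
pose Q := P - c + G ^+ 2 / 2 + 2 * kappa * D ^+ 2.
pose mu1 := 2 * (M / 2 + 1 / 2 + 2 * kappa + (`|Q| + 1) / (r / 2) ^+ 2).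
pose mu2 := 2 * (L + M) / (1 - c1).
have large_success k : enorm (x k - xs) <= r / 2 -> mu1 <= mu k -> mu2 <= mu k ->
    success k.
  move=> xk mu1k mu2k.
  have Kk : ecball xs r (x k) by rewrite /ecball /=; lra.
  have phik : fine (phi (x k)) <= P.
    have := run_value_nonincreasing (leq0n k); rewrite {1}/run_value /P.
    have := errL Kk Kxs; rewrite ler_norml => /andP[+ _].
    have := normr_dotv_le (gradient f xs) (x k - xs).
    rewrite ler_norml => /andP[+ _].
    have : enorm (gradient f xs) * enorm (x k - xs) <= G * r.
      by apply: ler_pM; rewrite ?enorm_ge0// gradient_bound.
    have : L * enorm (x k - xs) ^+ 2 <= L * r ^+ 2.
      by rewrite ler_wpM2l ?(ltW L0)// lerXn2r ?nnegrE ?enorm_ge0// ltW.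
    by lra.
  have Dk : enorm (x k - xb) <= D.
    by have := enorm_triangle xs (x k) xb; rewrite /D; lra.
  have loc y : effdom phi y ->
      quad_increment f (x k) (B k) (mu k) y + fine (phi y) <= fine (phi (x k)) ->
      enorm (y - x k) <= r / 2.
    apply: (sublevel_localized kappa0 _ (BM k) phi_ge Dk (gradient_bound Kk) phik).
      by rewrite divr_gt0.
    by move: mu1k; rewrite /mu1 /Q; lra.
  have r2 : 0 < r / 2 by rewrite divr_gt0.
  have := run_search run (minimizer_exists phi_ninfty phi_lsc r2 (run_dom k) loc).
  case xhatE : (xhat k) => [z|]// _; exists z => //.
  have zmin := run_found run xhatE.
  have zdom := minimizer_dom phi_ninfty (run_dom k) zmin.
  have Kz : ecball xs r z.
    have := minimizer_le phi_ninfty zdom (run_dom k) zmin.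
    rewrite quad_increment0 add0r => /(loc z zdom).
    by have := enorm_triangle (x k) z xs; rewrite /ecball /=; lra.
  exact: (sufficient_decrease phi_ninfty errL (BM k) L0 M0 c1_bounds mu2k Kk Kz
    (run_dom k) zdom zmin).
exists (Num.max mumax (sigma2 * Num.max mu1 mu2)); elim=> [|k IH] xk.
  by rewrite le_max; have /andP[_ ->] := run_mu0 run.
have [/(run_success run)[_ _ /andP[_ +]]|nSk] := pselect (success k).
  by rewrite le_max => ->.
have [xE _ ->] := run_failure run nSk.
rewrite le_max; apply/orP; right; rewrite ler_pM2l ?(lt_trans ltr01)//.
rewrite le_max -[_ || _]negbK negb_or -!ltNge; apply/negP => /andP[m1 m2].
by apply: nSk; apply: large_success; rewrite -?xE// ltW.
Qed.

Section Convergence.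
Context (mubar : R).
Hypothesis mu_near : forall k, enorm (x k - xs) <= r / 2 -> mu k <= mubar.
Hypothesis xs_dom : effdom phi xs.
Hypothesis acc : forall d, 0 < d -> forall K, exists l,
  [/\ (K <= l)%N, success l & enorm (x l - xs) < d].

Lemma value_limit_le : lower_semicontinuous (objective f phi) ->
  forall k, f xs + fine (phi xs) <= run_value k.
Proof.
move=> F_lsc k; rewrite leNgt; apply/negP; rewrite -lte_fin.
rewrite -(objective_fineE f phi_ninfty xs_dom) => /F_lsc[V /nbhs_enormP[d d0 dV] FV].
have [l [kl _ xl]] := acc d0 k.
have := FV _ (dV _ xl); rewrite run_valueE lte_fin ltNge.
by rewrite run_value_nonincreasing.
Qed.

(** Some successful step starts near [xs], is short, and ends with an objective
    value close to the one at [xs]. *)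
Lemma short_step_near_limit : lower_semicontinuous (objective f phi) ->
  forall d, 0 < d -> exists l, [/\ success l, enorm (x l - xs) < d,
    enorm (x l.+1 - x l) < d & run_value l.+1 < f xs + fine (phi xs) + d].
Proof.
move=> F_lsc d d0.
have [r_gt0 L_gt0 M_gt0] : [/\ 0 < r, 0 < L & 0 < M] by [].
(* The constant of [value_after_step], plus 1 so that [C * tau < d] also gives
   [tau < d]. *)
pose C := 4 * G + M + Num.max mubar 0 + 4 * L + 1.
have mb0 : 0 <= Num.max mubar 0 by rewrite le_max lexx orbT.
have C1 : 1 <= C by have := G_ge0; rewrite /C; lra.
pose tau := Num.min (d / C / 2) (Num.min 1 (r / 2)).
have C0 : 0 < C by lra.
have tau0 : 0 < tau by rewrite !lt_min ltr01 !divr_gt0 ?divr_gt0.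
have tauC : C * tau < d.
  have : tau <= d / C / 2 by rewrite ge_min lexx.
  rewrite -(ler_pM2l C0) => /le_lt_trans; apply.
  have -> : C * (d / C / 2) = d / 2 by field; rewrite gt_eqF.
  by lra.
have taud : tau < d.
  by rewrite (le_lt_trans _ tauC)// ler_peMl// ltW.
have tau1 : tau <= 1 by rewrite /tau !ge_min lexx orbT.
have taur : tau <= r / 2 by rewrite /tau !ge_min lexx !orbT.
have a0 : 0 < c1 * mumin / 2 by case/andP: c1_bounds => ? _; rewrite !mulr_gt0.
(* The values decrease to a limit, so eventually their increments are small. *)
have noninc : nonincreasing_seq run_value.
  by move=> ? ?; exact: run_value_nonincreasing.
have lb : has_lbound (range run_value).
  by exists (f xs + fine (phi xs)) => _ [k _ <-]; exact: value_limit_le.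
set l0 := inf (range run_value).
have l0_le k : l0 <= run_value k by apply: ge_inf => //; exists k.
have e0 : 0 < c1 * mumin / 2 * tau ^+ 2 by rewrite mulr_gt0// exprn_gt0.
have [K _ KP] : \forall k \near \oo, run_value k < l0 + c1 * mumin / 2 * tau ^+ 2.
  by apply: cvgr_lt (nonincreasing_cvgn noninc lb) _ _; rewrite -/l0 ltrDl.
have [l [Kl Sl xl]] := acc tau0 K; exists l.
have step_small : enorm (x l.+1 - x l) < tau.
  rewrite -(ltr_pXn2r (ltn0Sn 1)) ?nnegrE ?enorm_ge0 ?(ltW tau0)//.
  rewrite -(ltr_pM2l a0); have := success_decrease Sl.
  by have := KP l Kl; have := l0_le l.+1; lra.
split=> //; try exact: lt_trans taud.
have xlr : enorm (x l - xs) <= r / 2 by rewrite ltW// (lt_le_trans xl).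
have Kl' : ecball xs r (x l) by rewrite /ecball /=; lra.
have KlS : ecball xs r (x l.+1).
  by rewrite /ecball /=; have := enorm_triangle (x l) (x l.+1) xs; lra.
have mu_l : 0 <= mu l <= Num.max mubar 0.
  rewrite le_max mu_near//= andbT.
  by rewrite (le_trans _ (run_mu_ge l))// ltW.
have := value_after_step phi_ninfty errL L0 (ltW M0) mu_l (BM l) xs_dom
  (run_dom l) Kxs Kl' KlS (gradient_bound Kxs) (gradient_bound Kl')
  (ltW xl) (ltW step_small) tau1 (success_minimizer Sl).
rewrite -/(run_value l.+1) => /le_lt_trans; apply; rewrite ltrD2l.
by apply: le_lt_trans tauC; rewrite ler_pM2r// /C; lra.
Qed.

Lemma run_converges : lower_semicontinuous (objective f phi) ->
  KL_property (objective f phi) xs -> x @ \oo --> xs.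
Proof.
move=> F_lsc KL.
have [r_gt0 L_gt0 M_gt0] : [/\ 0 < r, 0 < L & 0 < M] by [].
have a0 : 0 < c1 * mumin / 2 by case/andP: c1_bounds => ? _; rewrite !mulr_gt0.
pose b := L + M + Num.max mubar 0.
have b0 : 0 < b.
  have : 0 <= Num.max mubar 0 by rewrite le_max lexx orbT.
  by rewrite /b; lra.
have r2 : 0 < r / 2 by rewrite divr_gt0.
have subgrad k : success k -> enorm (x k - xs) < r / 2 ->
    enorm (x k.+1 - xs) < r / 2 ->
    exists2 v, limiting_subdiff (objective f phi) (x k.+1) v &
      enorm v <= b * enorm (x k.+1 - x k).
  move=> Sk xk xkS.
  have mu0 : 0 <= mu k by rewrite (le_trans _ (run_mu_ge k))// ltW.
  have [v vF vb] := subgradient_step phi_ninfty gradL errL L0 r0 (ltW M0) mu0 (BM k)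
    (run_sym k) (run_dom k) (ltW xk) (ltW xkS) (success_minimizer Sk).
  exists v => //; rewrite (le_trans vb)// ler_wpM2r ?enorm_ge0//.
  by rewrite /b lerD2l le_max mu_near// ltW.
apply: (KL_convergence a0 b0 r2 KL (objective_fineE f phi_ninfty xs_dom) run_valueE).
- exact: value_limit_le.
- move=> k; have [Sk|nSk] := pselect (success k); last first.
    by left; have [-> _ _] := run_failure run nSk.
  by right; split; [exact: success_decrease|exact: subgrad].
move=> d d0; have m0 : 0 < Num.min (d / 2) (r / 4) by rewrite lt_min !divr_gt0.
have [l [Sl xl sl Fl]] := short_step_near_limit F_lsc m0.
have [md mr] : Num.min (d / 2) (r / 4) <= d / 2 /\ Num.min (d / 2) (r / 4) <= r / 4.
  by rewrite !ge_min !lexx orbT.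
have xlS := enorm_triangle (x l) (x l.+1) xs.
exists l.+1, (enorm (x l.+1 - x l)); split.
- by lra.
- by lra.
- by rewrite enorm_ge0/=; lra.
- by apply: subgrad => //; lra.
Qed.

End Convergence.
End NearPoint.
End Run.

(** Accumulation along an infinite set of indices, made explicit. *)
Lemma accumulation_point_alongP {R : realType} {n : nat}
    (x : nat -> 'rV[R]_n) (S : set nat) (a : 'rV[R]_n) :
  accumulation_point_along x S a ->
  forall d, 0 < d -> forall K, exists l,
    [/\ (K <= l)%N, S l & enorm (x l - a) < d].
Proof.
move=> [I [infI IS xa]] d d0 K; apply: contrapT => none; apply: infI.
have : nbhs a [set y | enorm (y - a) < d] by apply/nbhs_enormP; exists d.
move=> /xa [N _ NP]; apply: (@sub_finite_set _ _ `I_(maxn N K)).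
  move=> l Il /=; rewrite ltnNge geq_max; apply/negP => /andP[Nl Kl].
  by apply: none; exists l; split=> //; [exact: IS|exact: NP].
exact: finite_II.
Qed.

Theorem theorem4p3 (R : realType) (n : nat)
    (f : 'rV[R]_n -> R) (phi : 'rV[R]_n -> \bar R)
    (phi_ninfty : no_ninfty phi)
    (F_proper : proper_function (objective f phi))
    (F_lsc : lower_semicontinuous (objective f phi))
    (f_C1 : exists O : set 'rV[R]_n,
      [/\ open O, effdom phi `<=` O & continuously_differentiable_on f O])
    (phi_proper : proper_function phi)
    (phi_lsc : lower_semicontinuous phi)
    (phi_prox : prox_bounded phi)
    (F_bounded : (-oo < ereal_inf (range (objective f phi)))%E)
    (c1 sigma2 mumin mumax : R)
    (c1_bounds : 0 < c1 < 1) (sigma2_gt1 : 1 < sigma2)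
    (mumin_gt0 : 0 < mumin) (mumin_le : mumin <= mumax)
    (x : nat -> 'rV[R]_n) (B : nat -> 'M[R]_n) (mu : nat -> R)
    (xhat : nat -> option 'rV[R]_n)
    (run : algorithm_run f phi c1 sigma2 mumin mumax x B mu xhat)
    (B_bounded : exists2 MB : R, 0 < MB & forall k, opnorm (B k) <= MB)
    (grad_lipschitz : forall y, effdom phi y ->
      locally_lipschitz_at (gradient f) y)
    (stationary_nonempty : stationary (objective f phi) !=set0)
    (xstar : 'rV[R]_n)
    (xstar_stationary : stationary (objective f phi) xstar)
    (xstar_accumulation :
      accumulation_point_along x (successful f phi c1 x B xhat) xstar)
    (xstar_KL : KL_property (objective f phi) xstar) :
  x @ \oo --> xstar.
Proof.
have xs_dom : effdom phi xstar.
  by case: xstar_stationary => + _; rewrite /objective /effdom /= ltey;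
    apply: contraTneq => ->; rewrite addey.
have [V [oV domV fC1]] := f_C1.
have [L [r [L0 r0 gradL errL]]] :=
  first_order_error oV (domV _ xs_dom) fC1 (grad_lipschitz _ xs_dom).
have [M M0 BM] := B_bounded.
have [mubar mu_near] := mu_bounded_near phi_ninfty c1_bounds sigma2_gt1
  mumin_gt0 run L0 r0 M0 gradL errL BM phi_lsc phi_prox.
exact: (run_converges phi_ninfty c1_bounds sigma2_gt1 mumin_gt0 run L0 r0 M0
  gradL errL BM mu_near xs_dom (accumulation_point_alongP xstar_accumulation)
  F_lsc xstar_KL).
Qed.
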